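(* If $M$ is continuous, then for any $\lambda \in (c^{-1}, 1]$ $$H_\lambda'(0) = \lim_{x \downarrow 0} \frac{H_\lambda(x)}{x} = M \left( \lambda^{1/\alpha} \right).$$
   Context: Fix $\alpha\in(0,1)$, $c>1$, and a nonconstant function $M:(0,\infty)\to(0,\infty)$ with $M(c^{1/\alpha}x)=M(x)$ for all $x>0$ and such that $x\mapsto M(x)x^{-\alpha}$ is nonincreasing on $(0,\infty)$. For $\lambda\in(c^{-1},1]$ put $R_\lambda(x)=-M(\lambda^{1/\alpha}x)/x^\alpha$, $x>0$, and let $V_\lambda$ be a nonnegative random variable (semistable law) with characteristic function $$\mathbb{E}e^{itV_\lambda}=\exp\left\{\int_0^\infty(e^{itx}-1)\,dR_\lambda(x)\right\}.$$ For $\lambda\in(c^{-1},1]$ and $x>0$ let $h_\lambda(x)=\lambda x\, c^{-\lceil\log_c(\lambda x)\rceil}\in(c^{-1},1]$ and $$H_\lambda(x)=\mathbb{P}\left((V_{h_\lambda(x)})^{-\alpha}\le x\right).$$ $H_\lambda$ is a distribution function on $(0,\infty)$ (with $H_\lambda(0)=0$). *)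

(* Defs.v *)
From HB Require Import structures.
From mathcomp Require Import all_boot all_order all_algebra.
From mathcomp Require Import complex.
From mathcomp Require Import all_classical all_reals all_analysis.

Set Implicit Arguments.
Unset Strict Implicit.
Unset Printing Implicit Defensive.

Import Order.TTheory GRing.Theory Num.Theory.
Import numFieldNormedType.Exports.

Local Open Scope classical_set_scope.
Local Open Scope ring_scope.

Definition cexp (R : realType) (z : R[i]) : R[i] :=
  (expR (complex.Re z))%:C%C *
  (cos (complex.Im z) +i* sin (complex.Im z))%C.

Definition cintegral (R : realType) (d : measure_display)
    (T : measurableType d) (mu : {measure set T -> \bar R}) (D : set T)
    (f : T -> R[i]) : R[i] :=
  (Rintegral mu D (fun x => complex.Re (f x)) +i*
   Rintegral mu D (fun x => complex.Im (f x)))%C.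

(* [nu] restricted to (0, +oo) is the Lebesgue-Stieltjes measure dG of a
   function G on (0, +oo).  G may tend to -oo at 0+, so the library's
   [lebesgue_stieltjes_measure], which needs a real-valued cumulative function
   on the whole line, does not apply directly.  The values on the intervals
   ]a, b] with 0 < a determine the measure on (0, +oo). *)
Definition stieltjes_pos (R : realType) (G : R -> R)
    (nu : {measure set R -> \bar R}) : Prop :=
  forall a b : R, 0 < a -> a < b -> nu `]a, b]%classic = (G b - G a)%:E.

Section semistable.
Variable R : realType.

(* R_lambda *)
Definition levyfun (alpha : R) (M : R -> R) (l x : R) : R :=
  - M (l `^ alpha^-1 * x) / x `^ alpha.

(* The law of X has characteristic function
   exp (\int_0^oo (e^{itx} - 1) d nu(x)). *)
Definition has_levy_charfun (d : measure_display) (T : measurableType d)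
    (P : probability T R) (X : {RV P >-> R})
    (nu : {measure set R -> \bar R}) : Prop :=
  forall t : R,
    cintegral P setT (fun w => cexp (0 +i* (t * X w))%C) =
    cexp (cintegral nu `]0, +oo[%classic (fun x => cexp (0 +i* (t * x))%C - 1)).

Definition log_base (c x : R) : R := ln x / ln c.

(* h_lambda(x), for x > 0 *)
Definition hindex (c l x : R) : R :=
  l * x * c ^ (- Num.ceil (log_base c (l * x))).

(* H_lambda, extended by 0 to x <= 0.  Since (V)^{-alpha} = +oo when V = 0
   (whereas [0 `^ (- alpha) = 0] in the library), the event V^{-alpha} <= x
   carries the condition 0 < V. *)
Definition Hdist (alpha c : R) (d : R -> measure_display)
    (T : forall l : R, measurableType (d l))
    (P : forall l : R, probability (T l) R)
    (V : forall l : R, {RV (P l) >-> R}) (l x : R) : R :=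
  if 0 < x then
    let h := hindex c l x in
    fine (P h [set w | 0 < V h w /\ V h w `^ (- alpha) <= x])
  else 0.

End semistable.

(* Main.v *)
Require Import Defs.
From HB Require Import structures.
From mathcomp Require Import all_boot all_order all_algebra.
From mathcomp Require Import complex.
From mathcomp Require Import all_classical all_reals all_analysis.
From mathcomp Require Import measurable_realfun ring lra.

Set Implicit Arguments.
Unset Strict Implicit.
Unset Printing Implicit Defensive.

Import Order.TTheory GRing.Theory Num.Theory.
Import numFieldNormedType.Exports.

Local Open Scope classical_set_scope.
Local Open Scope ring_scope.

(* Write q = c^(1/alpha) and t for the argument of H_lambda.  The periodicity
   of M shows that W_t = t^(1/alpha) V_{h(t)} has characteristic function
   exp (t psi), where psi is the exponent of V_lambda: W is a semistable
   subordinator, and H_lambda(t) = P(W_t >= 1).  The limit to compute is thus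
   the small-time asymptotics P(W_t >= 1) / t -> nu [1, +oo[ of a Levy process.

   Only E cos (u W_t) = exp (- t A(u)) cos (t B(u)) is used.  Differentiating it
   at t = 0 gives E f(W_t) / t -> \int f dnu for f = 1 - cos (u .), hence for
   every trigonometric polynomial f in cosines with f(0) = 0.  Among these the
   functions (1 - s^n)^m with s(x) = (1 + cos (pi x / b)) / 2 approximate the
   indicator of [1, b], and near 0 they are small compared with 1 - cos.  The
   mass beyond b is controlled by covering [q^n, +oo[ by the annuli
   [q^m, q^(m+1)[ and applying Markov's inequality to 1 - cos (q^(-m-1) .),
   with A(u / q) = A(u) / c and B(u / q) = B(u) / c. *)

(** * Measures on the positive half-line: uniqueness and scaling *)

(** The measures may have infinite mass near 0, so the uniqueness theorem is applied to their
    restrictions to [D n], which are finite; continuity from below along the increasing sets [A] cut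
    by [D n] then gives all of [A]. *)
Lemma eq_measure_itv_oc_pos (R : realType) (m1 m2 : {measure set R -> \bar R}) :
  (forall a b : R, 0 < a -> a < b -> m1 `]a, b]%classic = m2 `]a, b]%classic) ->
  (forall a b : R, 0 < a -> a < b -> (m1 `]a, b]%classic < +oo)%E) ->
  forall A : set R, measurable A -> A `<=` `]0, +oo[%classic -> m1 A = m2 A.
Proof.
move=> m12 m1fin A mA A0.
pose D (n : nat) : set R := `]n.+1%:R^-1, n.+2%:R]%classic.
have mD n : measurable (D n) by exact: measurable_itv.
have Dpos n : (0 : R) < n.+1%:R^-1 by rewrite invr_gt0 ltr0n.
have Dlt n : n.+1%:R^-1 < n.+2%:R :> R.
  by rewrite (@le_lt_trans _ _ 1) ?invf_le1 ?ltr0n ?ler1n ?ltr1n.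
have AD : A = \bigcup_n (A `&` D n).
  rewrite -setI_bigcupr; apply/seteqP; split=> [x Ax|x []//]; split=> //.
  have x0 : 0 < x by have := A0 _ Ax; rewrite /= in_itv/= andbT.
  pose n := (Num.truncn x + Num.truncn x^-1)%N; exists n => //.
  rewrite /D /= in_itv/=; apply/andP; split.
    rewrite invf_plt ?posrE ?ltr0n//.
    rewrite (lt_le_trans (truncnS_gt _))// ler_nat ltnS /n leq_addl//.
  rewrite (le_trans (ltW (truncnS_gt _)))// ler_nat ltnS /n.
  by rewrite (leq_trans (leq_addr _ _) (leqnSn _)).
have ndD : nondecreasing_seq (fun n => A `&` D n).
  move=> m n mn; apply/subsetPset; apply: setIS => x.
  rewrite /D /= !in_itv/= => /andP[x1 x2]; apply/andP; split.
    by rewrite (le_lt_trans _ x1)// lef_pV2 ?posrE ?ltr0n// ler_nat.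
  by rewrite (le_trans x2)// ler_nat !ltnS.
suff E n : m1 (A `&` D n) = m2 (A `&` D n).
  have mAD n : measurable (A `&` D n) by exact: measurableI.
  have mU : measurable (\bigcup_n (A `&` D n)) by rewrite -AD.
  have c1 := nondecreasing_cvg_mu (mu:=m1) mAD mU ndD.
  have c2 := nondecreasing_cvg_mu (mu:=m2) mAD mU ndD.
  rewrite AD; apply: (cvg_unique _ c1) => //.
  by rewrite (_ : m1 \o _ = m2 \o (fun n => A `&` D n))//; apply/funext => k /=.
(* Cutting by [D n] keeps intervals half-open with a positive left end. The result may be empty,
   which is why [a' < b'] is not claimed. *)
have DI a b : exists a' b' : R, 0 < a' /\ `]a, b]%classic `&` D n = `]a', b']%classic.
  exists (Num.max a n.+1%:R^-1), (Num.min b n.+2%:R); split.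
    by rewrite lt_max Dpos orbT.
  apply/seteqP; split=> x; rewrite /D /= !in_itv/= gt_max le_min.
    by move=> [/andP[-> ->] /andP[-> ->]].
  by move=> /andP[/andP[-> ->] /andP[-> ->]].
rewrite -[m1 _]/(mrestr m1 (mD n) A) -[m2 _]/(mrestr m2 (mD n) A).
apply: (@measure_unique _ R _ (@ocitv R) (fun n => `]- n%:R, n%:R]%classic)) => //.
- exact: ocitvI.
- by move=> i; exact: is_ocitv.
- apply/seteqP; split=> // x _; exists (Num.truncn `|x|).+1 => //=.
  have xlt := truncnS_gt `|x|.
  rewrite in_itv/=; apply/andP; split.
    by rewrite ltrNl (le_lt_trans _ xlt)// -normrN ler_norm.
  by rewrite (le_trans (ler_norm _))// ltW.
- move=> _ [[a b] _ <-] /=; rewrite /mrestr.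
  have [a' [b' [a'0 ->]]] := DI a b.
  have [a'b'|b'a'] := ltP a' b'; first exact: m12.
  by rewrite set_itv_ge ?measure0// bnd_simp -leNgt.
- move=> k; rewrite /mrestr (@le_lt_trans _ _ (m1 (D n)))//; last exact: m1fin.
  by apply: le_measure => //; rewrite ?inE//; apply: measurableI.
Qed.

(* Both sides are [0] when the integral of [f] diverges. *)
Lemma Rintegral_scale_pos (R : realType) (nu1 nu2 : {measure set R -> \bar R})
    (y k : R) : 0 < y -> 0 < k ->
  (forall a b : R, 0 < a -> a < b ->
     nu1 `]y * a, y * b]%classic = (k%:E * nu2 `]a, b]%classic)%E) ->
  (forall a b : R, 0 < a -> a < b -> (nu2 `]a, b]%classic < +oo)%E) ->
  forall f : R -> R, measurable_fun setT f ->
  Rintegral nu1 `]0, +oo[%classic (fun x => f (y^-1 * x)) =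
  k * Rintegral nu2 `]0, +oo[%classic f.
Proof.
move=> y0 k0 nu12 nu2fin f mf.
have mD : measurable (`]0, +oo[%classic : set R) by exact: measurable_itv.
have k0' := ltW k0.
have mphi : measurable_fun setT ( *%R y^-1) by exact: mulrl_measurable.
(* For nonnegative integrands this is a change of variables: the image of [nu1] under division by
   [y] and the multiple [k * nu2] agree on half-open intervals. The general case follows by
   splitting into positive and negative parts. *)
have ge0E (g : R -> \bar R) : measurable_fun setT g -> (forall x, 0 <= g x)%E ->
    (\int[nu1]_(x in `]0%R, +oo[%classic) g (y^-1 * x)%R =
     k%:E * \int[nu2]_(x in `]0%R, +oo[%classic) g x)%E.
  move=> mg g0.
  rewrite -(@ge0_integral_mscale _ _ _ nu2 _ mD (NngNum k0')); last 2 first.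
  - exact: measurable_funTS.
  - by move=> ? _.
  pose m1_ := (pushforward nu1 ( *%R y^-1) : {measure set R -> \bar R}).
  pose m1 := m1_ mphi.
  pose m2 : {measure set R -> \bar R} := mscale (NngNum k0') nu2.
  transitivity (\int[m1]_(x in `]0%R, +oo[%classic) g x)%E.
    rewrite (ge0_integral_pushforward mphi)//; last exact: measurable_funTS.
    congr (integral _ _ _); apply/seteqP; split=> x; rewrite /= !in_itv/= !andbT => x0.
      by rewrite mulr_gt0 ?invr_gt0.
    by rewrite -(pmulr_rgt0 x (x := y^-1)) ?invr_gt0.
  rewrite -[RHS]/(\int[m2]_(x in `]0%R, +oo[%classic) g x)%E.
  apply: eq_measure_integral => A mA AD.
  have m1E (a b : R) : 0 < a -> a < b ->
      m1 `]a, b]%classic = (k%:E * nu2 `]a, b]%classic)%E.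
    move=> a0 ab; rewrite -nu12// -[LHS]/(nu1 (( *%R y^-1) @^-1` `]a, b]%classic)).
    congr (nu1 _); apply/seteqP; split=> x; rewrite /= !in_itv/=.
      by rewrite ltr_pdivlMl// ler_pdivrMl.
    by rewrite ltr_pdivlMl// ler_pdivrMl.
  apply: (@eq_measure_itv_oc_pos R m1 m2) => // a b a0 ab.
  by rewrite m1E// lte_mul_pinfty ?lee_fin//; exact: nu2fin.
have mEf : measurable_fun setT (EFin \o f) by exact/measurable_EFinP.
rewrite /Rintegral integralE [in RHS]integralE.
have -> : (\int[nu1]_(x in `]0%R, +oo[) (fun x0 => (f (y^-1 * x0))%:E)^\+ x =
    k%:E * \int[nu2]_(x in `]0%R, +oo[) (EFin \o f)^\+ x)%E.
  by rewrite -ge0E//; [by apply: eq_integral => x _; rewrite !funeposE|exact: measurable_funepos].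
have -> : (\int[nu1]_(x in `]0%R, +oo[) (fun x0 => (f (y^-1 * x0))%:E)^\- x =
    k%:E * \int[nu2]_(x in `]0%R, +oo[) (EFin \o f)^\- x)%E.
  by rewrite -ge0E//; [by apply: eq_integral => x _; rewrite !funenegE|exact: measurable_funeneg].
have : (0 <= \int[nu2]_(x in `]0%R, +oo[) (EFin \o f)^\+ x)%E.
  by apply: integral_ge0 => x _; exact: funepos_ge0.
have : (0 <= \int[nu2]_(x in `]0%R, +oo[) (EFin \o f)^\- x)%E.
  by apply: integral_ge0 => x _; exact: funeneg_ge0.
rewrite -[(fun x => (f x)%:E)]/(EFin \o f).
move: (\int[nu2]_(x in _) (EFin \o f)^\- x)%E => n.
move: (\int[nu2]_(x in _) (EFin \o f)^\+ x)%E => p.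
case: p => [p||]//; case: n => [n||]//= _ _;
  rewrite -?EFinM ?(gt0_muley, lte_fin)//= ?mulr0//.
by rewrite mulrBr.
Qed.

(** * Elementary estimates for cosines and geometric sequences *)

Lemma onem_cos_le_norm (R : realType) (y : R) : 1 - cos y <= `|y|.
Proof.
wlog y0 : y / 0 <= y => [wlogy|].
  have [/wlogy//|/ltW y0] := leP 0 y.
  by rewrite -cosN -normrN wlogy// oppr_ge0.
have [x _] : exists2 x, x \in `[0, y] & cos y - cos 0 = - sin x * (y - 0).
  apply: (@MVT_segment R cos (- sin)) => //.
  exact/continuous_subspaceT/continuous_cos.
rewrite cos0 subr0 ger0_norm// => E.
have -> : 1 - cos y = sin x * y by lra.
by rewrite ler_piMl// sin_le1.
Qed.

Lemma onem_cos_ge0 (R : realType) (y : R) : 0 <= 1 - cos y.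
Proof. by rewrite subr_ge0 cos_le1. Qed.

Lemma onem_cos_le2 (R : realType) (y : R) : 1 - cos y <= 2.
Proof. by have := cos_geN1 y; lra. Qed.

(** The left side is [(1 - expR (- x)) + expR (- x) * (1 - cos y)]. With [x] and [y] proportional to
    t this bounds the mean of [1 - cos (u W_t)] linearly in t. *)
Lemma onem_expR_cos_le (R : realType) (x y : R) : 0 <= x ->
  1 - expR (- x) * cos y <= x + `|y|.
Proof.
move=> x0; have ex1 : expR (- x) <= 1 by rewrite expR_le1; lra.
have := expR_ge1Dx (- x); have ex0 := expR_ge0 (- x).
have := ler_wpM2l ex0 (onem_cos_le_norm y).
have := ler_piMl (normr_ge0 y) ex1.
by move: `|y| (cos y) (expR (- x)) => *; lra.
Qed.

Lemma measurable_onem_cos (R : realType) (u : R) :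
  measurable_fun setT (fun x => 1 - cos (u * x)).
Proof.
apply: measurable_funB => //; apply: measurableT_comp => //.
by apply: continuous_measurable_fun; exact: continuous_cos.
Qed.

Lemma exists_expr_lt (R : realType) (r e : R) : 0 <= r < 1 -> 0 < e ->
  exists n, r ^+ n < e.
Proof.
move=> /andP[r0 r1] e0.
have /cvgrPdist_lt/(_ e e0) : geometric 1 r @ \oo --> (0 : R).
  by apply: cvg_geometric; rewrite ger0_norm.
move=> [n _ /(_ n (leqnn n))]; rewrite /= mul1r sub0r normrN ger0_norm ?exprn_ge0//.
by exists n.
Qed.

Lemma bigcup_itv_geometric (R : realType) (r : R) : 0 < r < 1 ->
  \bigcup_n `]r ^+ n.+1, r ^+ n]%classic = `]0, 1]%classic.
Proof.
move=> /andP[r0 r1]; have r0' := ltW r0; have r1' := ltW r1.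
apply/seteqP; split=> [x [n _]|x]; rewrite /= !in_itv/= => /andP[x1 x2].
  by rewrite (le_lt_trans _ x1) ?exprn_ge0// (le_trans x2)// exprn_ile1.
have exn : exists n, r ^+ n.+1 < x.
  have [|n xn] := @exists_expr_lt _ r x _ x1; first by rewrite r0'.
  by exists n; rewrite (le_lt_trans _ xn)// ler_wiXn2l.
(* Minimality of the index gives [x <= r ^+ n]; for index 0 this is the assumption [x <= 1]. *)
exists (ex_minn exn) => //; rewrite /= in_itv/=.
case: ex_minnP => n -> nmin /=; case: n nmin => [|n] nmin; first by rewrite expr0.
by rewrite leNgt; apply/negP => /nmin; rewrite ltnn.
Qed.

Lemma trivIset_itv_geometric (R : realType) (r : R) : 0 < r < 1 ->
  trivIset setT (fun n => `]r ^+ n.+1, r ^+ n]%classic).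
Proof.
move=> /andP[r0 r1]; apply: ltn_trivIset => i j ij; rewrite -subset0 => x [].
rewrite /= !in_itv/= => /andP[x1 x2] /andP[x3 x4].
have : r ^+ i <= r ^+ j.+1 by rewrite ler_wiXn2l// ltW.
by rewrite leNgt (lt_le_trans x1 x4).
Qed.

(** * The Levy measure: tails and integrability *)

Section semistable_levy_measure.
Variables (R : realType) (nu : {measure set R -> \bar R}) (q c : R) (g : R -> R).
Hypotheses (c_gt1 : 1 < c) (c_lt_q : c < q).
Hypothesis nuE : forall a b : R, 0 < a -> a < b ->
  nu `]a, b]%classic = (g a - g b)%:E.
Hypothesis g_scale : forall a : R, 0 < a -> g (q^-1 * a) = c * g a.

Let q_gt1 : 1 < q. Proof. exact: lt_trans c_gt1 c_lt_q. Qed.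
Let q_gt0 : 0 < q. Proof. exact: lt_trans ltr01 q_gt1. Qed.
Let c_gt0 : 0 < c. Proof. exact: lt_trans ltr01 c_gt1. Qed.

Lemma g_scaleX n a : 0 < a -> g (q^-1 ^+ n * a) = c ^+ n * g a.
Proof.
move=> a0; elim: n => [|n IH]; first by rewrite !expr0 !mul1r.
by rewrite exprS -mulrA g_scale ?mulr_gt0 ?exprn_gt0 ?invr_gt0// IH exprS mulrA.
Qed.

(** The scaling relation forces [g (q ^+ n * a) = c^-1 ^+ n * g a], so [g] vanishes at infinity and
    the increment over ]a, q^n a] tends to [g a]. *)
Lemma levy_tail a : 0 < a -> nu `]a, +oo[%classic = (g a)%:E.
Proof.
move=> a0.
have gX n : g (q ^+ n * a) = c^-1 ^+ n * g a.
  have /(@g_scaleX n) : 0 < q ^+ n * a by rewrite mulr_gt0 ?exprn_gt0.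
  rewrite mulrA exprVn mulVf ?mul1r ?expf_neq0 ?gt_eqF// => ->.
  by rewrite exprVn mulrA mulVf ?mul1r// expf_neq0 ?gt_eqF.
have cover : `]a, +oo[%classic = \bigcup_n `]a, q ^+ n * a]%classic.
  apply/seteqP; split=> [x|x [n _]]; rewrite /= !in_itv/= ?andbT; last by case/andP.
  move=> ax; have x0 := lt_trans a0 ax.
  have [||n qn] := @exists_expr_lt _ q^-1 (a / x).
  - by rewrite invr_ge0 ltW//= invf_lt1.
  - by rewrite divr_gt0.
  exists n => //; rewrite /= in_itv/= ax/=.
  move: qn; rewrite exprVn ltr_pdivlMr// mulrC ltr_pdivrMr ?exprn_gt0//.
  by rewrite mulrC => /ltW.
have nd : nondecreasing_seq (fun n => `]a, q ^+ n * a]%classic).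
  move=> m n mn; apply/subsetPset => x; rewrite /= !in_itv/= => /andP[-> /le_trans]; apply.
  by rewrite ler_wpM2r ?ler_weXn2l ?ltW.
rewrite cover.
have mD n : measurable (`]a, q ^+ n * a]%classic : set R) by exact: measurable_itv.
apply: (cvg_unique _ (nondecreasing_cvg_mu (mu := nu) mD (bigcupT_measurable _ mD) nd)) => //.
suff : (fun n => (g a - c^-1 ^+ n * g a)%:E) @ \oo --> (g a)%:E.
  (* Index 0 is left out because [nuE] needs a nondegenerate interval. *)
  apply: cvg_trans; apply: near_eq_cvg; exists 1%N => // n n1 /=.
  by rewrite -gX nuE// -{1}(mul1r a) ltr_pM2r// exprn_egt1// -lt0n.
apply: cvg_EFin; first by apply: nearW.
rewrite [X in X @ \oo --> _](_ : _ = (fun n => g a - geometric (g a) c^-1 n)); last first.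
  by apply/funext => n /=; rewrite mulrC.
rewrite -[X in _ --> X]subr0; apply: cvgB; first exact: cvg_cst.
by apply: cvg_geometric; rewrite ger0_norm ?invf_lt1// invr_ge0 ltW.
Qed.

(** Beyond 1, [f] is bounded and [nu] has mass [g 1]. On ]q^-(n+1), q^-n] the mass is c^n (c - 1)
    g(1) and [f] is at most K q^-n, so the contributions near 0 are dominated by a geometric series
    of ratio c/q < 1. *)
Lemma levy_integrable (f : R -> R) (K : R) : measurable_fun setT f ->
  (forall x, `|f x| <= K) -> (forall x, 0 < x -> `|f x| <= K * x) ->
  nu.-integrable `]0, +oo[%classic (EFin \o f).
Proof.
move=> mf fK fKx.
have K0 : 0 <= K by exact: le_trans (fK 0).
have mEf D : measurable_fun D (fun x => `|(f x)%:E|%E).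
  by apply/measurable_funTS/measurableT_comp => //; exact/measurable_EFinP.
have lb D C : measurable D -> 0 <= C -> (forall x, D x -> `|f x| <= C) ->
    (\int[nu]_(x in D) `|(f x)%:E| <= C%:E * nu D)%E.
  move=> mD C0 fC; apply: integral_le_bound => //.
    by apply/measurable_funTS; exact/measurable_EFinP.
  by apply: aeW => x Dx; rewrite lee_fin fC.
have r01 : 0 < q^-1 < 1 by rewrite invr_gt0 q_gt0 invf_lt1.
apply/integrableP; split; first by apply/measurable_funTS; exact/measurable_EFinP.
have -> : `]0, +oo[%classic = `]0, 1]%classic `|` `]1, +oo[%classic :> set R.
  apply/seteqP; split=> x; rewrite /= !in_itv/= ?andbT.
    by move=> x0; case: (leP x 1) => ?; [left; rewrite x0|right].
  by case=> [/andP[]//|]; exact: lt_trans.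
rewrite /= ge0_integral_setU//=; last first.
  rewrite disj_set2E; apply/eqP; rewrite -subset0 => x [].
  by rewrite /= !in_itv/= => /andP[_ x1]; rewrite andbT ltNge x1.
apply: lte_add_pinfty; last first.
  apply: (le_lt_trans (lb _ _ _ K0 _)) => //.
  by rewrite levy_tail// -EFinM ltry.
rewrite -(bigcup_itv_geometric r01) ge0_integral_bigcup//; last first.
- exact: trivIset_itv_geometric.
pose rho := c / q.
have rho0 : 0 < rho by rewrite divr_gt0.
have rho1 : rho < 1 by rewrite ltr_pdivrMr// mul1r.
pose B := K * g 1 * (c - 1).
apply: (@le_lt_trans _ _ (\sum_(i <oo) (geometric B rho i)%:E)%E).
  apply: lee_nneseries => [i _ _|n _]; first exact: integral_ge0.
  apply: (le_trans (lb _ (K * q^-1 ^+ n) _ _ _)) => //.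
  - by rewrite mulr_ge0// exprn_ge0// invr_ge0 ltW.
  - move=> x; rewrite /= in_itv/= => /andP[x0 xn].
    rewrite (le_trans (fKx _ _))//; last by rewrite ler_wpM2l.
    by rewrite (lt_trans _ x0)// exprn_gt0// invr_gt0.
  rewrite nuE ?exprn_gt0 ?invr_gt0//; last first.
    by rewrite exprS gtr_pMl ?exprn_gt0 ?invr_gt0// invf_lt1.
  have gE m : g (q^-1 ^+ m) = c ^+ m * g 1 by rewrite -[X in g X]mulr1 g_scaleX.
  rewrite !gE -EFinM lee_fin /geometric/= /B /rho expr_div_n exprS exprVn.
  rewrite le_eqVlt; apply/orP; left; apply/eqP; ring.
have B0 : 0 <= B.
  rewrite /B !mulr_ge0// ?subr_ge0; last exact: ltW.
  by rewrite -lee_fin -levy_tail.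
apply: (@le_lt_trans _ _ (B / (1 - rho))%:E); last exact: ltry.
apply: lime_le.
  by apply: is_cvg_nneseries => i _ _; rewrite lee_fin mulr_ge0// exprn_ge0// ltW.
apply: nearW => n; rewrite sumEFin lee_fin.
by apply: geometric_le_lim => //; rewrite ger0_norm// ltW.
Qed.

Lemma levy_integrable_onem_cos u :
  nu.-integrable `]0, +oo[%classic (EFin \o (fun x => 1 - cos (u * x))).
Proof.
apply: (levy_integrable (K := Num.max 2 `|u|)).
- exact: measurable_onem_cos.
- by move=> x; rewrite ger0_norm ?onem_cos_ge0// le_max onem_cos_le2.
- move=> x x0; rewrite ger0_norm ?onem_cos_ge0// (le_trans (onem_cos_le_norm _))//.
  by rewrite normrM (gtr0_norm x0) ler_wpM2r ?le_max ?lexx ?orbT// ltW.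
Qed.

End semistable_levy_measure.

(** * Polynomials approximating a step *)

Lemma bernoulli_inequality (R : realDomainType) (x : R) n : -1 <= x ->
  1 + n%:R * x <= (1 + x) ^+ n.
Proof.
move=> x1; elim: n => [|n IH]; first by rewrite mul0r addr0 expr0.
have x1' : 0 <= 1 + x by lra.
rewrite exprS; apply: le_trans (ler_wpM2l x1' IH).
have : 0 <= n%:R * x ^+ 2 :> R by rewrite mulr_ge0// ?sqr_ge0.
by rewrite -natr1; move: (n%:R) => k; lra.
Qed.

(** Since (1 - y)^m (1 + y)^m = (1 - y^2)^m is at most 1, Bernoulli's inequality for (1 + y)^m gives
    the bound. *)
Lemma onem_exp_le (R : realFieldType) (y : R) m : 0 <= y <= 1 ->
  (1 - y) ^+ m <= (1 + m%:R * y)^-1.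
Proof.
move=> /andP[y0 y1]; have my : 0 < 1 + m%:R * y :> R.
  by rewrite ltr_wpDr// mulr_ge0.
rewrite -div1r ler_pdivlMr//.
apply: (@le_trans _ _ ((1 - y) ^+ m * (1 + y) ^+ m)).
  rewrite ler_wpM2l ?exprn_ge0 ?subr_ge0// bernoulli_inequality//; lra.
by rewrite -exprMn exprn_ile1//; nra.
Qed.

(* The polynomials [(1 - s ^+ n) ^+ m] approximate the indicator of
   [s < m ^ (-1/n)]; see Brosowski and Deutsch's proof of Stone-Weierstrass. *)
Lemma step_polynomial (R : realType) (lo hi e : R) :
  0 < lo -> lo < hi -> hi <= 1 -> 0 < e ->
  exists n m : nat,
    (forall s, 0 <= s <= lo -> 1 - e <= (1 - s ^+ n) ^+ m.+1) /\
    (forall s, hi <= s <= 1 -> (1 - s ^+ n) ^+ m.+1 <= e * (1 - s)).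
Proof.
move=> lo0 lohi hi1 e0; have hi0 := lt_trans lo0 lohi; have lo1 := lt_le_trans lohi hi1.
pose rho := lo / hi; have rho0 : 0 < rho by rewrite divr_gt0.
have rho1 : rho < 1 by rewrite ltr_pdivrMr ?mul1r.
pose d := rho^-1 - 1; have d0 : 0 < d by rewrite subr_gt0 invf_gt1.
(* Bernoulli's inequality for rho^-j = (1 + d)^j. *)
have jrho j : j%:R * rho ^+ j <= d^-1.
  rewrite -ler_pdivlMr ?exprn_gt0// -exprVn -ler_pdivrMl ?invr_gt0// invrK.
  have := @bernoulli_inequality _ d j (ltac:(lra)).
  by rewrite (_ : 1 + d = rho^-1) /d; [move: (_ ^+ j) (j%:R) => *; lra|ring].
have C0 : 0 < 2 / (e * d) + 2 by rewrite addr_gt0// divr_gt0// mulr_gt0.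
have [j jlt] := @exists_expr_lt _ (Num.max rho lo) (e / (2 / (e * d) + 2))
  (ltac:(by rewrite le_max gt_max ltW//= rho1 lo1)) (ltac:(by rewrite divr_gt0)).
have rhoj : rho ^+ j * (2 / (e * d)) + lo ^+ j * 2 <= e.
  move: jlt; rewrite ltr_pdivlMr// mulrDr => /ltW; apply: le_trans.
  have mono x : 0 < x -> x <= Num.max rho lo -> x ^+ j <= Num.max rho lo ^+ j.
    by move=> x0 xm; rewrite lerXn2r// ?nnegrE ?(le_trans (ltW x0))// ltW.
  rewrite lerD// ler_wpM2r// ?mono ?le_max ?lexx ?orbT//.
  by rewrite divr_ge0// mulr_ge0// ltW.
(* The exponent is doubled so that n rho^n = 2 rho^j (j rho^j), where the second factor is bounded
   and the first is small. The choice of [m] makes n at most e m hi^n, with an excess over n / (e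
   hi^n) of at most 1. *)
pose n := (j + j)%N; pose m := (Num.truncn (n%:R / (e * hi ^+ n))).+1.
have hin0 : 0 < hi ^+ n by exact: exprn_gt0.
have mge : n%:R / (e * hi ^+ n) <= m%:R by exact/ltW/truncnS_gt.
have mle : m%:R <= n%:R / (e * hi ^+ n) + 1.
  by rewrite -natr1 lerD2r truncn_le// divr_ge0// mulr_ge0// ltW.
exists n, m; split=> s /andP[s1 s2].
- have sn : s ^+ n <= lo ^+ n by rewrite lerXn2r// ?nnegrE// ltW.
  have sn1 : s ^+ n <= 1 by rewrite exprn_ile1// ltW// (le_lt_trans s2).
  apply: le_trans (bernoulli_inequality _ _); last by rewrite lerN2.
  (* It remains to bound (m + 1) lo^n, which is at most n rho^n / e + 2 lo^n. *)
  rewrite mulrN lerD2l lerN2.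
  apply: (@le_trans _ _ ((n%:R / (e * hi ^+ n) + 2) * lo ^+ n)).
    by rewrite ler_pM ?exprn_ge0// -natr1; lra.
  apply: le_trans rhoj; rewrite mulrDl lerD//; last first.
    by rewrite mulrC ler_wpM2r// ler_wiXn2l ?leq_addl ?ltW.
  rewrite (_ : _ / _ * _ = (rho ^+ j * (2 / e)) * (j%:R * rho ^+ j)); last first.
    by rewrite /rho /n exprD natrD expr_div_n exprD; field; rewrite !gt_eqF ?exprn_gt0.
  rewrite invfM (mulrA 2) [leRHS]mulrA ler_wpM2l//.
  by rewrite mulr_ge0 ?exprn_ge0 ?divr_ge0// ltW.
- have s0 := lt_le_trans hi0 s1.
  have hs : hi ^+ n <= s ^+ n by rewrite lerXn2r// ?nnegrE// ltW.
  have sn1 : s ^+ n <= 1 by rewrite exprn_ile1// ltW.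
  have sn0 : 0 < s ^+ n by rewrite exprn_gt0.
  (* One of the m + 1 factors is spent on producing [1 - s]; the other m give the small constant. *)
  have h1 : 1 - s ^+ n <= n%:R * (1 - s).
    have := @bernoulli_inequality _ (s - 1) n (ltac:(lra)).
    by rewrite [1 + (s - 1)]addrC subrK; move: (s ^+ n) (n%:R : R) => *; lra.
  have mh0 : 0 < m%:R * hi ^+ n by rewrite mulr_gt0// ltr0n.
  have h2 : (1 - s ^+ n) ^+ m <= (m%:R * hi ^+ n)^-1.
    apply: (le_trans (onem_exp_le _ _)); first by rewrite ltW.
    rewrite lef_pV2 ?posrE//; last by rewrite ltr_wpDr// mulr_ge0// ltW.
    by rewrite (le_trans (ler_wpM2l _ hs))// lerDr.
  rewrite exprS; apply: (@le_trans _ _ (n%:R * (1 - s) * (m%:R * hi ^+ n)^-1)).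
    by rewrite ler_pM// ?exprn_ge0// subr_ge0.
  rewrite mulrAC ler_wpM2r ?subr_ge0// ler_pdivrMr//.
  by move: mge; rewrite ler_pdivrMr ?mulr_gt0// mulrCA.
Qed.

(** * Comparing integrals with masses of sets *)

Section Rintegral_indic.
Context (d : measure_display) (T : measurableType d) (R : realType).
Variables (mu : {measure set T -> \bar R}) (D E : set T).
Hypotheses (mD : measurable D) (mE : measurable E) (ED : E `<=` D)
  (muE : (mu E < +oo)%E).

Let integrable_indicS : mu.-integrable D (EFin \o \1_E).
Proof.
apply/integrableP; split.
  by apply/measurable_EFinP; exact: measurable_indic.
rewrite (eq_integral (fun x => (\1_E x)%:E)) ?integral_indic// ?setIidl//.
by move=> x _; rewrite /= ger0_norm.
Qed.

Let Rintegral_indicS : \int[mu]_(x in D) \1_E x = fine (mu E).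
Proof. by rewrite /Rintegral integral_indic// setIidl. Qed.

Lemma Rintegral_ge_indic (k : R) (f : T -> R) : mu.-integrable D (EFin \o f) ->
  (forall x, D x -> k * \1_E x <= f x) ->
  k * fine (mu E) <= \int[mu]_(x in D) f x.
Proof.
move=> intf kf; rewrite -Rintegral_indicS -RintegralZl//.
apply: le_Rintegral => //.
rewrite (_ : _ \o _ = (fun x => k%:E * (EFin \o \1_E) x))%E//.
exact: integrableZl.
Qed.

Lemma Rintegral_le_indic (f h : T -> R) : mu.-integrable D (EFin \o f) ->
  mu.-integrable D (EFin \o h) -> (forall x, D x -> f x <= h x + \1_E x) ->
  \int[mu]_(x in D) f x <= \int[mu]_(x in D) h x + fine (mu E).
Proof.
move=> intf inth fh; rewrite -Rintegral_indicS -RintegralD//.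
apply: le_Rintegral => //.
rewrite (_ : _ \o _ = (EFin \o h) \+ (EFin \o \1_E))%E//.
exact: integrableD.
Qed.

End Rintegral_indic.

(** The final bookkeeping of [small_time_tail]: [X] is the tail of [mu t] at 1 divided by t, [I0],
    [I1], [I2] are the integrals of 1 - cos, of the lower and of the upper test function under
    [mu t] divided by t, and [A], [J1], [J2] their counterparts under [nu]. The values of the tail
    function at 1 and on either side of it are [g], [g1], [g2]; [d] is the error of the test
    functions and [k] the decay factor of the far tail. *)
Lemma sandwich_estimate (R : realFieldType)
    (e d A C g g1 g2 k I0 I1 I2 J1 J2 X : R) :
  0 < e -> 0 < d -> 0 <= A -> 0 <= C -> 0 <= g -> 0 < k ->
  k * (C + g + 1) < e / 8 -> d * (g + A + e + C + 1) <= e / 4 ->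
  `|g - g1| <= e / 8 -> `|g - g2| <= e / 8 -> `|A - I0| <= e / 8 ->
  `|J1 - I1| <= e / 8 -> `|J2 - I2| <= e / 8 ->
  I1 <= d * I0 + X -> X <= I2 + d * C + C * k ->
  (1 - d) * (g2 - k * g) <= J1 -> J2 <= d * A + g1 -> `|g - X| <= e.
Proof.
move=> e0 d0 A0 C0 g0 k0 ? ?; rewrite !ler_norml.
move=> /andP[? ?] /andP[? ?] /andP[? ?] /andP[? ?] /andP[? ?] ? ? ? ?.
have d0' := ltW d0.
have ? : 0 <= k * g by rewrite mulr_ge0// ltW.
have ? : 0 <= d * (k * g) by rewrite mulr_ge0.
have ? : 0 <= C * k by rewrite mulr_ge0// ltW.
have ? : 0 <= d * e by rewrite mulr_ge0// ltW.
have ? : 0 <= d * C by rewrite mulr_ge0.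
have ? : 0 <= d * A by rewrite mulr_ge0.
have ? : 0 <= d * g by rewrite mulr_ge0.
have ? : d * I0 <= d * (A + e / 8) by rewrite ler_wpM2l//; lra.
have ? : d * g2 <= d * (g + e / 8) by rewrite ler_wpM2l//; lra.
by apply/andP; split; lra.
Qed.

Lemma probability_integrable (d : measure_display) (T : measurableType d) (R : realType)
    (P : probability T R) (f : T -> R) (K : R) :
  measurable_fun setT f -> (forall x, `|f x| <= K) -> P.-integrable setT (EFin \o f).
Proof.
move=> mf fK; apply: measurable_bounded_integrable => //.
  by rewrite -ge0_fin_numE// fin_num_measure.
by exists K; split; [exact: num_real|move=> M KM x _ /=; exact: (le_trans (fK x) (ltW KM))].
Qed.

(** * Small-time asymptotics of the laws [mu t] *)

Section small_time.
Variables (R : realType) (nu : {measure set R -> \bar R}) (q c : R) (g : R -> R).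
Hypotheses (c_gt1 : 1 < c) (c_lt_q : c < q).
Hypothesis nuE : forall a b : R, 0 < a -> a < b ->
  nu `]a, b]%classic = (g a - g b)%:E.
Hypothesis g_scale : forall a : R, 0 < a -> g (q^-1 * a) = c * g a.

Variables (mu : R -> probability R R) (B : R -> R).
Let A (u : R) := \int[nu]_(x in `]0, +oo[) (1 - cos (u * x)).
Hypothesis mu_neg : forall t, 0 < t -> mu t `]-oo, 0[%classic = 0%E.
Hypothesis mu_cos : forall t u, 0 < t ->
  \int[mu t]_x cos (u * x) = expR (- (t * A u)) * cos (t * B u).
Hypothesis A_scale : forall u, A (q^-1 * u) = c^-1 * A u.
Hypothesis B_scale : forall u, B (q^-1 * u) = c^-1 * B u.

(** The test functions along which [mu t] divided by t converges to [nu]. Boundedness and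
    [nu]-integrability are carried along because linearity of the two integrals requires them. *)
Let good (f : R -> R) := [/\ measurable_fun setT f,
  exists K, forall x, `|f x| <= K,
  nu.-integrable `]0, +oo[%classic (EFin \o f) &
  t^-1 * \int[mu t]_x f x @[t --> 0^'+] --> \int[nu]_(x in `]0, +oo[) f x].

Let mupos : measurable (`]0, +oo[%classic : set R).
Proof. exact: measurable_itv. Qed.

Let integrable_onem_cos u :
  nu.-integrable `]0, +oo[%classic (EFin \o (fun x => 1 - cos (u * x))).
Proof. exact: levy_integrable_onem_cos c_gt1 c_lt_q nuE g_scale u. Qed.

Let A_ge0 u : 0 <= A u.
Proof. by apply: Rintegral_ge0 => x _; exact: onem_cos_ge0. Qed.

Let mu_onem_cos t u : 0 < t ->
  \int[mu t]_x (1 - cos (u * x)) = 1 - expR (- (t * A u)) * cos (t * B u).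
Proof.
move=> t0; rewrite RintegralB//; last 2 first.
- by apply: (@probability_integrable _ _ _ _ _ 1) => // x; rewrite normr1.
- apply: (@probability_integrable _ _ _ _ _ 1) => [|x]; last exact: cos_max.
  by apply: measurableT_comp => //; apply: continuous_measurable_fun; exact: continuous_cos.
by rewrite mu_cos// Rintegral_cst//= probability_setT/= mulr1.
Qed.

Let goodD f h : good f -> good h -> good (fun x => f x + h x).
Proof.
move=> [mf [K fK] nf cf] [mh [L hL] nh ch]; split.
- exact: measurable_funD.
- by exists (K + L) => x; rewrite (le_trans (ler_normD _ _))// lerD.
- by rewrite (_ : _ \o _ = (EFin \o f) \+ (EFin \o h))%E//; exact: integrableD.
- rewrite RintegralD//.
  rewrite (_ : (fun t => _) = (fun t => t^-1 * \int[mu t]_x f x + t^-1 * \int[mu t]_x h x)).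
    exact: cvgD.
  apply/funext => t; rewrite -mulrDr RintegralD//; [exact: probability_integrable mf fK|].
  exact: probability_integrable mh hL.
Qed.

Let goodZ k f : good f -> good (fun x => k * f x).
Proof.
move=> [mf [K fK] nf cf]; split.
- exact: measurable_funM.
- by exists (`|k| * K) => x; rewrite normrM ler_wpM2l.
- by rewrite (_ : _ \o _ = (fun x => k%:E * (EFin \o f) x))%E//; exact: integrableZl.
- rewrite RintegralZl//.
  rewrite (_ : (fun t => _) = (fun t => k * (t^-1 * \int[mu t]_x f x))).
    by apply: cvgM => //; exact: cvg_cst.
  apply/funext => t; rewrite mulrCA RintegralZl//; exact: probability_integrable mf fK.
Qed.

(** The limit is the derivative at 0 of [F], computed from the cosine transform. The oscillating
    factor contributes nothing to it, since sin 0 = 0. *)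
Let good_onem_cos u : good (fun x => 1 - cos (u * x)).
Proof.
split => //.
- exact: measurable_onem_cos.
- by exists 2 => x; rewrite ger0_norm ?onem_cos_le2 ?onem_cos_ge0.
pose F t := 1 - expR (- (t * A u)) * cos (t * B u).
have dF : is_derive (0 : R) 1 F (A u).
  rewrite /F; apply: is_derive_eq.
  rewrite !mul0r oppr0 expR0 cos0 sin0 /GRing.scale/=; ring.
suff : t^-1 * F t @[t --> 0^'+] --> A u.
  apply: cvg_trans; apply: near_eq_cvg; near=> t.
  by rewrite mu_onem_cos.
apply: cvg_dnbhs_at_right; have [dvF <-] := dF.
have : h^-1 *: (F (h *: 1 + 0) - F 0) @[h --> 0^'] --> 'D_1 F 0 by exact: dvF.
apply: cvg_trans; apply: near_eq_cvg; apply: nearW => h.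
rewrite /F !mul0r oppr0 expR0 cos0 mulr1 subrr subr0 addr0 /GRing.scale/= mulr1.
by [].
Unshelve. all: by end_near. Qed.

(* Unlike [good], [mgood] is stable under products with cosines, by the
   product-to-sum formula. *)
Let mgood (f : R -> R) := forall u, good (fun x => f x * (1 - cos (u * x))).

Let mgood_cst k : mgood (fun=> k).
Proof. by move=> u; exact: goodZ. Qed.

Let mgoodD f h : mgood f -> mgood h -> mgood (fun x => f x + h x).
Proof.
move=> mf mh u.
rewrite (_ : (fun x => _) =
  (fun x => f x * (1 - cos (u * x)) + h x * (1 - cos (u * x)))).
  exact: goodD.
by apply/funext => x; rewrite mulrDl.
Qed.

Let mgoodZ k f : mgood f -> mgood (fun x => k * f x).
Proof.
move=> mf u; rewrite (_ : (fun x => _) = (fun x => k * (f x * (1 - cos (u * x))))).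
  exact: goodZ.
by apply/funext => x; rewrite mulrA.
Qed.

Let mgood_cos v f : mgood f -> mgood (fun x => f x * cos (v * x)).
Proof.
move=> mf u.
(* The average of cos (u + v) and cos (u - v) is the product of cosines; the last term restores the
   constants so that every summand keeps a factor 1 - cos. *)
rewrite (_ : (fun x => _) = (fun x =>
  2^-1 * (f x * (1 - cos ((u + v) * x))) + 2^-1 * (f x * (1 - cos ((u - v) * x)))
  + (-1) * (f x * (1 - cos (v * x))))).
  by apply: goodD; [apply: goodD|]; exact: goodZ.
by apply/funext => x; rewrite mulrDl mulrBl cosD cosB; field.
Qed.

Section test_functions.
Variable v : R.
Let s x := (1 + cos (v * x)) / 2.

Let mgood_s f : mgood f -> mgood (fun x => f x * s x).
Proof.
move=> mf; rewrite (_ : (fun x => _) =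
  (fun x => 2^-1 * f x + 2^-1 * (f x * cos (v * x)))).
  by apply: mgoodD; apply: mgoodZ => //; exact: mgood_cos.
by apply/funext => x; rewrite /s; field.
Qed.

Let mgood_sX n f : mgood f -> mgood (fun x => f x * s x ^+ n).
Proof.
move=> mf; elim: n => [|n IH].
  by rewrite (_ : (fun x => _) = f)//; apply/funext => x; rewrite expr0 mulr1.
rewrite (_ : (fun x => _) = (fun x => f x * s x ^+ n * s x)).
  exact: mgood_s.
by apply/funext => x; rewrite exprSr mulrA.
Qed.

Let mgood_onem_sX n m : mgood (fun x => (1 - s x ^+ n) ^+ m).
Proof.
elim: m => [|m IH]; first exact: mgood_cst.
rewrite (_ : (fun x => _) = (fun x => (1 - s x ^+ n) ^+ m +
   (-1) * ((1 - s x ^+ n) ^+ m * s x ^+ n))).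
  by apply: mgoodD => //; apply: mgoodZ; exact: mgood_sX.
by apply/funext => x; rewrite exprSr; ring.
Qed.

(** By 1 - s^(k+1) = (1 - s^k) + s^k (1 - s) and 1 - s = (1 - cos) / 2, a factor 1 - s^k is a sum of
    terms each containing the factor 1 - cos that [mgood] asks for. *)
Lemma good_onem_sX n m : good (fun x => (1 - s x ^+ n) ^+ m.+1).
Proof.
suff H k f : mgood f -> good (fun x => f x * (1 - s x ^+ k)).
  rewrite (_ : (fun x => _) = (fun x => (1 - s x ^+ n) ^+ m * (1 - s x ^+ n))).
    exact/H/mgood_onem_sX.
  by apply/funext => x; rewrite exprSr.
move=> mf; elim: k => [|k IH].
  rewrite (_ : (fun x => _) = (fun x => 0 * (1 - cos (0 * x)))); first exact: goodZ.
  by apply/funext => x; rewrite expr0 subrr mulr0 mul0r.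
rewrite (_ : (fun x => _) = (fun x => f x * (1 - s x ^+ k) +
   2^-1 * (f x * s x ^+ k * (1 - cos (v * x))))).
  by apply: goodD => //; apply: goodZ; exact: mgood_sX.
by apply/funext => x; rewrite exprSr /s; field.
Qed.

End test_functions.

(** On [0, b] the function [s] decreases from 1 to 0, so a step polynomial in [s] between the levels
    s(a2) and s(a1) becomes a step in x between a1 and a2. *)
Let good_approx (a1 a2 b e : R) : 0 <= a1 -> a1 < a2 -> a2 < b -> 0 < e ->
  exists f, [/\ good f, forall x, 0 <= f x <= 1,
    forall x, 0 <= x <= a1 -> f x <= e * (1 - cos (pi / b * x)) &
    forall x, a2 <= x <= b -> 1 - e <= f x].
Proof.
move=> a10 a12 a2b e0; pose s x : R := (1 + cos (pi / b * x)) / 2.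
have b0 : 0 < b by lra.
have vi x : 0 <= x <= b -> pi / b * x \in `[0, pi].
  move=> /andP[x0 xb]; rewrite in_itv/= mulrAC divr_ge0 ?mulr_ge0 ?pi_ge0 ?(ltW b0)//=.
  by rewrite ler_pdivrMr// ler_wpM2l// pi_ge0.
have s_anti x y : 0 <= x -> x < y -> y <= b -> s y < s x.
  move=> x0 xy yb; rewrite /s ltr_pM2r ?invr_gt0// ltrD2l ltr_cos ?vi//; [|lra|lra].
  by rewrite ltr_pM2l// divr_gt0// pi_gt0.
have s_anti' x y : 0 <= x -> x <= y -> y <= b -> s y <= s x.
  by move=> x0; rewrite le_eqVlt => /predU1P[->//|xy yb]; apply/ltW/s_anti.
have s01 x : 0 <= s x <= 1.
  by rewrite /s; have := cos_le1 (pi / b * x); have := cos_geN1 (pi / b * x); lra.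
have [||||n [m [H1 H2]]] := @step_polynomial R (s a2) (s a1) e.
(* The strict inequality [a2 < b] makes the lower level positive. *)
- have : s b < s a2 by apply: s_anti => //; lra.
  by apply: le_lt_trans; have /andP[] := s01 b.
- by apply: s_anti => //; exact: ltW.
- by have /andP[] := s01 a1.
- by [].
exists (fun x => (1 - s x ^+ n) ^+ m.+1); split.
- exact: good_onem_sX.
- move=> x; have /andP[s0 s1] := s01 x.
  have ? : 0 <= s x ^+ n by exact: exprn_ge0.
  have ? : s x ^+ n <= 1 by exact: exprn_ile1.
  by rewrite exprn_ge0 ?exprn_ile1//; lra.
- move=> x /andP[x0 xa]; apply: (le_trans (H2 _ _)).
    by rewrite s_anti'//; [case/andP: (s01 x)|lra].
  rewrite ler_wpM2l ?(ltW e0)// /s; have := cos_le1 (pi / b * x); lra.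
- move=> x /andP[xa xb]; apply: H1.
  by rewrite s_anti'//; [case/andP: (s01 x) => -> _|lra].
Qed.

Let q_gt1 : 1 < q. Proof. exact: lt_trans c_gt1 c_lt_q. Qed.
Let q_gt0 : 0 < q. Proof. exact: lt_trans ltr01 q_gt1. Qed.
Let c_gt0 : 0 < c. Proof. exact: lt_trans ltr01 c_gt1. Qed.

(** The test functions are periodic, so they say nothing beyond [b]; this bound, linear in t and
    geometric in n, replaces them there. *)
Let mu_tail : exists2 C, 0 <= C & forall (t : R) n, 0 < t ->
  (mu t `[(q ^+ n)%R, +oo[%classic <= (t * (C * c^-1 ^+ n))%R%:E)%E.
Proof.
pose k : R := 1 - cos q^-1.
have qi : 0 < q^-1 < 1 by rewrite invr_gt0 q_gt0 invf_lt1.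
have k0 : 0 < k.
  rewrite subr_gt0 -[ltRHS]cos0 ltr_cos ?in_itv/= ?lexx ?pi_ge0//.
    by case/andP: qi.
  by have := @pi_ge2 R; lra.
(* The cosine decreases on [0, pi], which contains [q^-1, 1]. *)
have k_le y : q^-1 <= y <= 1 -> k <= 1 - cos y.
  move=> /andP[y1 y2]; rewrite lerD2l lerN2 leNgt ltr_cos -?leNgt// in_itv/=.
    by have := @pi_ge2 R; lra.
  by have := @pi_ge2 R; lra.
pose C0 := A 1 + `|B 1|.
have C00 : 0 <= C0 by rewrite addr_ge0.
have AX n : A (q^-1 ^+ n) = c^-1 ^+ n * A 1.
  by elim: n => [|n IH]; rewrite ?expr0 ?mul1r// !exprS A_scale IH mulrA.
have BX n : B (q^-1 ^+ n) = c^-1 ^+ n * B 1.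
  by elim: n => [|n IH]; rewrite ?expr0 ?mul1r// !exprS B_scale IH mulrA.
(* Dividing by [c - 1] turns the Markov bound c^-(m+1) C0 / k into C (c^-m - c^-(m+1)), which
   telescopes over the annuli. *)
pose C := C0 / k / (c - 1).
have C_ge0 : 0 <= C by rewrite !divr_ge0 ?(ltW k0)// subr_ge0 ltW.
have annulus (t : R) m : 0 < t -> (mu t `[(q ^+ m)%R, (q ^+ m.+1)%R[%classic <=
    (t * (C * (c^-1 ^+ m - c^-1 ^+ m.+1)))%R%:E)%E.
  move=> t0; have fmu : mu t `[q ^+ m, q ^+ m.+1[%classic \is a fin_num.
    exact: fin_num_measure.
  rewrite -[leLHS]fineK// lee_fin.
  have -> : t * (C * (c^-1 ^+ m - c^-1 ^+ m.+1)) = k^-1 * (t * (c^-1 ^+ m.+1 * C0)).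
    by rewrite /C exprS; field; rewrite !gt_eqF// subr_gt0.
  rewrite ler_pdivlMl//.
  apply: (@le_trans _ _ (\int[mu t]_x (1 - cos (q^-1 ^+ m.+1 * x)))).
    apply: Rintegral_ge_indic => //.
    - by rewrite -ge0_fin_numE.
    - have [mf [K fK] _ _] := good_onem_cos (q^-1 ^+ m.+1).
      exact: probability_integrable mf fK.
    - move=> x _; rewrite indicE; case: (boolP (x \in _)) => [|_]; last first.
        by rewrite mulr0 onem_cos_ge0.
      rewrite inE/= in_itv/= mulr1 => /andP[x1 x2]; apply: k_le; apply/andP; split.
        rewrite exprS -mulrA ler_peMr ?invr_ge0 ?(ltW q_gt0)//.
        by rewrite exprVn ler_pdivlMl ?exprn_gt0 ?mulr1.
      by rewrite exprVn ler_pdivrMl ?exprn_gt0// mulr1 ltW.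
  rewrite mu_onem_cos// AX BX.
  set a := c^-1 ^+ m.+1; have a0 : 0 <= a by rewrite exprn_ge0// invr_ge0 ltW.
  have /onem_expR_cos_le : 0 <= t * (a * A 1) by rewrite !mulr_ge0// ltW.
  move=> /(_ (t * (a * B 1)))/le_trans; apply.
  by rewrite /C0 !normrM (gtr0_norm t0) (ger0_norm a0); move: `|B 1| => ?; lra.
exists C => // t n t0.
have part j : (mu t `[(q ^+ n)%R, (q ^+ (n + j))%R[%classic <=
    (t * (C * (c^-1 ^+ n - c^-1 ^+ (n + j))))%R%:E)%E.
  elim: j => [|j IH].
    by rewrite addn0 set_itv_ge ?measure0 ?subrr ?mulr0// bnd_simp ltxx.
  have -> : `[q ^+ n, q ^+ (n + j.+1)[%classic = `[q ^+ n, q ^+ (n + j)[%classic `|`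
      `[q ^+ (n + j), q ^+ (n + j).+1[%classic.
    rewrite addnS; apply/seteqP; split=> x; rewrite /= !in_itv/=.
      by move=> /andP[x1 x2]; case: (ltP x (q ^+ (n + j))) => ?; [left; rewrite x1|right].
    case=> /andP[x1 x2]; apply/andP; split => //.
      by rewrite (lt_le_trans x2)// ler_weXn2l ?leqnSn// ltW.
    by rewrite (le_trans _ x1)// ler_weXn2l ?leq_addr// ltW.
  apply: (le_trans (measureU2 _ _ _)) => //.
  apply: (le_trans (leeD IH (annulus t (n + j)%N t0))).
  by rewrite -EFinD lee_fin addnS le_eqVlt; apply/orP; left; apply/eqP; ring.
have cover : `[q ^+ n, +oo[%classic = \bigcup_j `[q ^+ n, q ^+ (n + j)[%classic.
  apply/seteqP; split=> [x|x [j _]]; rewrite /= !in_itv/= ?andbT; last by case/andP.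
  move=> nx; have x0 : 0 < x by rewrite (lt_le_trans _ nx)// exprn_gt0.
  have [||j qj] := @exists_expr_lt _ q^-1 (q ^+ n / x).
  - by case/andP: qi => /ltW ->.
  - by rewrite divr_gt0// exprn_gt0.
  exists j => //; rewrite /= in_itv/= nx/=.
  by move: qj; rewrite exprVn ltr_pdivlMr// mulrC ltr_pdivrMr ?exprn_gt0// -exprD.
have nd : nondecreasing_seq (fun j => `[q ^+ n, q ^+ (n + j)[%classic).
  move=> i j ij; apply/subsetPset => x; rewrite /= !in_itv/= => /andP[-> /lt_le_trans]; apply.
  by rewrite ler_weXn2l ?leq_add2l ?ltW.
have mF j : measurable (`[q ^+ n, q ^+ (n + j)[%classic : set R) by exact: measurable_itv.
have cF := nondecreasing_cvg_mu (mu := mu t) mF (bigcupT_measurable _ mF) nd.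
rewrite cover -(cvg_lim _ cF)//; apply: lime_le; first by apply/cvg_ex; eexists; exact: cF.
apply: nearW => j; apply: (le_trans (part j)); rewrite lee_fin ler_wpM2l ?(ltW t0)//.
by rewrite ler_wpM2l// gerBl exprn_ge0// invr_ge0 ltW.
Qed.

Let levy_tail_ge0 a : 0 < a -> 0 <= g a.
Proof. by move=> a0; rewrite -lee_fin -(levy_tail c_gt1 c_lt_q nuE g_scale a0). Qed.

(** The indicator of [1, +oo[ is trapped between [f1], which rises between 1 and [a2], and [f2],
    which rises between [a1] and 1, up to errors of size [d] and a tail beyond [b]. Continuity of
    [g] at 1 makes the two [nu]-integrals close. *)
Theorem small_time_tail : {for 1, continuous g} ->
  t^-1 * fine (mu t `[1, +oo[%classic) @[t --> 0^'+] --> g 1.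
Proof.
move=> gc; apply/cvgrPdist_le => e e0.
have [C C0 tailC] := mu_tail.
have g1 : 0 <= g 1 by exact: levy_tail_ge0.
have e8 : 0 < e / 8 by rewrite divr_gt0.
have r1 : 0 <= c^-1 < 1 by rewrite invr_ge0 ltW//= invf_lt1.
have d0 : 0 < e / 8 / (C + g 1 + 1) by rewrite !divr_gt0//; lra.
have [n0 n0P] := exists_expr_lt r1 d0.
(* The successor ensures b > 1. Beyond [b], both the mass of [nu] and the bound on [mu t] divided by
   t are at most e/8. *)
pose n := n0.+1; pose b := q ^+ n.
have b1 : 1 < b by rewrite /b exprn_egt1.
have cn : c^-1 ^+ n * (C + g 1 + 1) < e / 8.
  rewrite -ltr_pdivlMr; last lra.
  by apply: le_lt_trans n0P; rewrite ler_wiXn2l//; lra.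
have cn0 : 0 < c^-1 ^+ n by rewrite exprn_gt0// invr_gt0.
have gb : g b = c^-1 ^+ n * g 1.
  have := @g_scaleX _ q c g c_gt1 c_lt_q g_scale n b (ltac:(lra)).
  rewrite /b exprVn mulVf ?expf_neq0 ?gt_eqF// => ->.
  by rewrite exprVn mulrA mulVf ?mul1r// expf_neq0 ?gt_eqF.
have [r /= r0 gr] : exists2 r, 0 < r & forall a, `|1 - a| < r -> `|g 1 - g a| <= e / 8.
  move/cvgrPdist_le : gc => /(_ _ e8)[r /= r0 gr].
  by exists r => // a ar; apply: gr.
(* The three bounds keep [a1] and [a2] within the radius of continuity, [a1] positive and [a2] below
   [b]. *)
pose r' := Num.min (r / 2) (Num.min (1 / 2) ((b - 1) / 2)).
have r'0 : 0 < r' by rewrite !lt_min; lra.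
have [r'1 r'2 r'3] : [/\ r' <= r / 2, r' <= 1 / 2 & r' <= (b - 1) / 2].
  by rewrite /r' !ge_min !lexx !orbT.
pose a1 := 1 - r'; pose a2 := 1 + r'.
have a10 : 0 < a1 by rewrite /a1; lra.
have a11 : a1 < 1 by rewrite /a1; lra.
have a21 : 1 < a2 by rewrite /a2; lra.
have a2b : a2 < b by rewrite /a2; lra.
have a20 : 0 < a2 by exact: lt_trans a21.
have ga1 : `|g 1 - g a1| <= e / 8.
  by apply: gr; rewrite /a1 opprB addrC subrK ger0_norm; lra.
have ga2 : `|g 1 - g a2| <= e / 8.
  by apply: gr; rewrite /a2 opprD addrA subrr add0r normrN ger0_norm; lra.
pose v := pi / b; pose S := g 1 + A v + e + C + 1.
have Av := A_ge0 v.
have S0 : 0 < S by rewrite /S; lra.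
(* Every error proportional to [d] is controlled by [d * S], hence by e/4. *)
pose d := Num.min 1 (e / 4 / S).
have {}d0 : 0 < d by rewrite lt_min !divr_gt0//; lra.
have d1 : d <= 1 by rewrite ge_min lexx.
have dS : d * S <= e / 4 by rewrite -ler_pdivlMr// /d ge_min lexx orbT.
have [f1 [good1 f1_01 f1_lo f1_hi]] : exists f, [/\ good f, forall x, 0 <= f x <= 1,
    forall x, 0 <= x <= 1 -> f x <= d * (1 - cos (v * x)) &
    forall x, a2 <= x <= b -> 1 - d <= f x].
  by apply: good_approx.
have [f2 [good2 f2_01 f2_lo f2_hi]] : exists f, [/\ good f, forall x, 0 <= f x <= 1,
    forall x, 0 <= x <= a1 -> f x <= d * (1 - cos (v * x)) &
    forall x, 1 <= x <= b -> 1 - d <= f x].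
  by apply: good_approx; rewrite // ltW.
have [_ _ _ /cvgrPdist_le/(_ _ e8) cv0] := good_onem_cos v.
have [_ _ _ /cvgrPdist_le/(_ _ e8) cv1] := good1.
have [_ _ _ /cvgrPdist_le/(_ _ e8) cv2] := good2.
have nu_f1 : (1 - d) * (g a2 - g b) <= \int[nu]_(x in `]0, +oo[) f1 x.
  have [_ _ intf1 _] := good1.
  have E : fine (nu `]a2, b]%classic) = g a2 - g b by rewrite nuE.
  rewrite -E; apply: Rintegral_ge_indic => //.
  - by move=> x; rewrite /= !in_itv/= andbT => /andP[/(lt_trans a20)].
  - by rewrite nuE// ltry.
  - move=> x _; rewrite indicE; case: (boolP (x \in _)) => [|_]; last first.
      by rewrite mulr0; case/andP: (f1_01 x).
    by rewrite inE/= in_itv/= mulr1 => /andP[x1 x2]; apply: f1_hi; rewrite ltW.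
have nu_f2 : \int[nu]_(x in `]0, +oo[) f2 x <= d * A v + g a1.
  have [_ _ intf2 _] := good2.
  have [_ _ intdv _] := goodZ d (good_onem_cos v).
  have E := levy_tail c_gt1 c_lt_q nuE g_scale a10.
  have -> : g a1 = fine (nu `]a1, +oo[%classic) by rewrite E.
  rewrite /A -RintegralZl//; apply: Rintegral_le_indic => //.
  - by move=> x; rewrite /= !in_itv/= !andbT; exact: lt_trans.
  - by rewrite E ltry.
  - move=> x; rewrite /= in_itv/= andbT indicE => x0; case: (boolP (x \in _)) => [_|].
      have /andP[_ ?] := f2_01 x; have := onem_cos_ge0 (v * x) => ?.
      by rewrite ler_wpDl// mulr_ge0// ltW.
    rewrite notin_setE/= in_itv/= andbT addr0 => /negP; rewrite -leNgt => xa1.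
    by apply: f2_lo; rewrite (ltW x0).
near=> t.
have t0 : 0 < t by near: t; exact: nbhs_right_gt.
set X := fine _.
have mu_f1 : \int[mu t]_x f1 x <= d * \int[mu t]_x (1 - cos (v * x)) + X.
  have [mf1 [K1 fK1] _ _] := good1; have [mdv [K fK] _ _] := goodZ d (good_onem_cos v).
  have [mv [K' fK'] _ _] := good_onem_cos v.
  have intv := probability_integrable (mu t) mv fK'.
  (* The bound [f1_lo] holds only for x >= 0, so the negative half-line joins the exceptional set;
     it is null for [mu t]. *)
  pose N : set R := `]-oo, 0[%classic.
  have mN1 : measurable (N `|` `[1, +oo[%classic).
    by apply: measurableU; exact: measurable_itv.
  have fN : (mu t (N `|` `[1%R, +oo[%classic) <= mu t `[1%R, +oo[%classic)%E.
    have := measureU2 (mu t) (measurable_itv `]-oo, (0 : R)[) (measurable_itv `[(1 : R), +oo[).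
    by rewrite [X in (_ <= X + _)%E -> _](mu_neg t0) add0e.
  rewrite -RintegralZl//.
  apply: (@le_trans _ _ (\int[mu t]_x (d * (1 - cos (v * x))) +
      fine (mu t (N `|` `[1, +oo[%classic)))).
    apply: Rintegral_le_indic => //.
    - by rewrite -ge0_fin_numE// fin_num_measure.
    - exact: probability_integrable mf1 fK1.
    - exact: probability_integrable mdv fK.
    - move=> x _; rewrite indicE; case: (boolP (x \in _)) => [_|].
        have /andP[_ ?] := f1_01 x; have := onem_cos_ge0 (v * x) => ?.
        by rewrite ler_wpDl// mulr_ge0// ltW.
      rewrite notin_setE /N /= !in_itv/= andbT addr0 => /not_orP[/negP x0 /negP x1].
      by apply: f1_lo; rewrite leNgt x0/= ltW// ltNge.
  by rewrite lerD2l fine_le// fin_num_measure.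
have mu_f2 : X <= \int[mu t]_x f2 x + d * (t * C) + t * (C * c^-1 ^+ n).
  have [mf2 [K2 fK2] _ _] := good2.
  have m1 : measurable (`[1, b[%classic : set R) by exact: measurable_itv.
  have m2 : measurable (`[b, +oo[%classic : set R) by exact: measurable_itv.
  have fin D : measurable D -> mu t D \is a fin_num by exact: fin_num_measure.
  have H1 : (1 - d) * fine (mu t `[1, b[%classic) <= \int[mu t]_x f2 x.
    apply: Rintegral_ge_indic => //.
    - by rewrite -ge0_fin_numE// fin.
    - exact: probability_integrable mf2 fK2.
    - move=> x _; rewrite indicE; case: (boolP (x \in _)) => [|_]; last first.
        by rewrite mulr0; case/andP: (f2_01 x).
      by rewrite inE/= in_itv/= mulr1 => /andP[x1 x2]; apply: f2_hi; rewrite x1 ltW.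
  have H2 : fine (mu t `[b, +oo[%classic) <= t * (C * c^-1 ^+ n).
    by rewrite -lee_fin fineK ?fin// tailC.
  (* The tail bound at q^0 = 1. It makes the loss of the factor 1 - d in [H1] an error of order d
     t. *)
  have H3 : fine (mu t `[1, b[%classic) <= t * C.
    rewrite -lee_fin fineK ?fin//; have := tailC t 0%N t0.
    rewrite !expr0 mulr1; apply: le_trans; rewrite le_measure ?inE// => x.
    by rewrite /= !in_itv/= andbT => /andP[].
  have H4 : X <= fine (mu t `[1, b[%classic) + fine (mu t `[b, +oo[%classic).
    rewrite /X -fineD ?fin// fine_le ?fin_numD ?fin//.
    apply: le_trans (measureU2 _ m1 m2); rewrite le_measure ?inE//; first exact: measurableU.
    move=> x; rewrite /= !in_itv/= !andbT => x1.
    by have [|] := ltP x b; [left; rewrite x1|right].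
  have H5 := ler_wpM2l (ltW d0) H3.
  apply: le_trans H4 _; apply: lerD H2; rewrite -lerBlDr; apply: le_trans H1.
  by rewrite mulrBl mul1r lerB.
have cv0' : `|A v - t^-1 * \int[mu t]_x (1 - cos (v * x))| <= e / 8 by near: t.
have cv1' : `|\int[nu]_(x in `]0, +oo[) f1 x - t^-1 * \int[mu t]_x f1 x| <= e / 8 by near: t.
have cv2' : `|\int[nu]_(x in `]0, +oo[) f2 x - t^-1 * \int[mu t]_x f2 x| <= e / 8 by near: t.
have {}mu_f1 : t^-1 * \int[mu t]_x f1 x <=
    d * (t^-1 * \int[mu t]_x (1 - cos (v * x))) + t^-1 * X.
  by rewrite mulrCA -mulrDr ler_pM2l ?invr_gt0.
have {}mu_f2 : t^-1 * X <= t^-1 * \int[mu t]_x f2 x + d * C + C * c^-1 ^+ n.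
  rewrite ler_pdivrMl// !mulrDr mulrA divff ?gt_eqF// mul1r.
  by rewrite (mulrCA t d).
rewrite gb in nu_f1.
exact: sandwich_estimate e0 d0 Av C0 g1 cn0 cn dS ga1 ga2 cv0' cv1' cv2'
  mu_f1 mu_f2 nu_f1 nu_f2.
Unshelve. all: by end_near.
Qed.

End small_time.

(** * From characteristic functions to the distribution function *)

Lemma Re_levy_charfun (R : realType) (d : measure_display) (T : measurableType d)
    (P : probability T R) (X : {RV P >-> R}) (nu : {measure set R -> \bar R})
    (t : R) : has_levy_charfun X nu ->
  \int[P]_w cos (t * X w) =
  expR (\int[nu]_(x in `]0, +oo[) (cos (t * x) - 1)) *
  cos (\int[nu]_(x in `]0, +oo[) sin (t * x)).
Proof.
move=> /(_ t)/(congr1 (@complex.Re R)); rewrite /cintegral /cexp /=.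
rewrite expR0 !mul0r !subr0 => E.
transitivity (\int[P]_w (1 * cos (t * X w) - 0 * sin (t * X w))).
  by apply: eq_Rintegral => w _; rewrite mul1r mul0r subr0.
rewrite {}E; f_equal; first congr expR; last congr cos.
  by apply: eq_Rintegral => x _; rewrite mul1r mul0r subr0.
by apply: eq_Rintegral => x _; rewrite mul1r mul0r addr0 subr0.
Qed.

(** In logarithmic form the index is [expR ((L - k%:~R) * ln c)] with [k] the ceiling of [L], and
    [L - k] lies in ]-1, 0]. *)
Lemma hindex_itv (R : realType) (c l x : R) : 1 < c -> 0 < l -> 0 < x ->
  hindex c l x \in `]c^-1, 1].
Proof.
move=> c1 l0 x0; have c0 : 0 < c by exact: lt_trans c1.
have lnc : 0 < ln c by exact: ln_gt0.
have lx : 0 < l * x by exact: mulr_gt0.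
rewrite /hindex; set L := log_base c (l * x); set k := Num.ceil L.
have -> : l * x * c ^ (- k) = expR ((L - k%:~R) * ln c).
  rewrite -powR_intmul ?(ltW c0)// /powR gt_eqF// intrN mulrBl expRD mulNr.
  by rewrite /L /log_base divfK ?gt_eqF// lnK.
have Lk : L <= k%:~R by exact: ceil_ge.
have kL : k%:~R - 1 < L by rewrite -[X in _ - X]/(1%:~R) -intrB ceilB1_lt.
rewrite in_itv/= expR_le1 pmulr_lle0// subr_le0 Lk andbT.
rewrite -[c in c^-1]lnK// -expRN ltr_expR -[ltLHS]mulN1r ltr_pM2r//; lra.
Qed.

Lemma periodic_exprz (R : realFieldType) (M : R -> R) (q x : R) (z : int) :
  0 < q -> (forall y, 0 < y -> M (q * y) = M y) -> 0 < x -> M (q ^ z * x) = M x.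
Proof.
move=> q0 Mq; have MX n y : 0 < y -> M (q ^+ n * y) = M y.
  elim: n y => [|n IH] y y0; first by rewrite expr0 mul1r.
  by rewrite exprS -mulrA Mq ?IH// mulr_gt0// exprn_gt0.
case: z => n x0; first exact: MX.
rewrite -[q ^ _]/((q ^+ n.+1)^-1) -(MX n.+1) ?mulr_gt0 ?invr_gt0 ?exprn_gt0//.
by rewrite mulrA divff ?mul1r// gt_eqF// exprn_gt0.
Qed.

(** The powers of t cancel inside [M], leaving an integer power of c^(1/alpha) that periodicity
    removes; the denominator contributes the factor t. Hence t^(1/alpha) V_h(t) has Levy measure t
    times that of V_l. *)
Lemma levyfun_hindex (R : realType) (alpha c : R) (M : R -> R) (l t x : R) :
  0 < alpha -> 1 < c -> (forall x : R, 0 < x -> M (c `^ alpha^-1 * x) = M x) ->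
  0 < l -> 0 < t -> 0 < x ->
  levyfun alpha M (hindex c l t) (t `^ (- alpha^-1) * x) = t * levyfun alpha M l x.
Proof.
move=> a0 c1 Mper l0 t0 x0; have c0 : 0 < c by exact: lt_trans c1.
have q0 : 0 < c `^ alpha^-1 by exact: powR_gt0.
rewrite /levyfun /hindex; set k := Num.ceil _.
have -> : (l * t * c ^ (- k)) `^ alpha^-1 * (t `^ (- alpha^-1) * x) =
    (c `^ alpha^-1) ^ (- k) * (l `^ alpha^-1 * x).
  rewrite !powRM ?mulr_ge0 ?ltW// ?exprz_gt0//.
  rewrite -!powR_intmul ?(ltW c0) ?(ltW q0)// powRAC powRN.
  by field; rewrite gt_eqF// powR_gt0.
rewrite periodic_exprz//; last by rewrite mulr_gt0// powR_gt0.
rewrite powRM ?powR_ge0 ?ltW// -powRrM [- alpha^-1 * _]mulNr mulVf ?gt_eqF// powR_inv1 ?ltW//.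
by field; rewrite !gt_eqF// powR_gt0.
Qed.

Theorem theorem4p5 (R : realType) (alpha c : R) (M : R -> R)
    (alpha01 : 0 < alpha < 1) (c_gt1 : 1 < c)
    (M_gt0 : forall x : R, 0 < x -> 0 < M x)
    (M_nonconst : exists x y : R, [/\ 0 < x, 0 < y & M x <> M y])
    (M_period : forall x : R, 0 < x -> M (c `^ alpha^-1 * x) = M x)
    (M_noninc : forall x y : R, 0 < x -> x <= y ->
       M y * y `^ (- alpha) <= M x * x `^ (- alpha))
    (nu : R -> {measure set R -> \bar R})
    (nu_levy : forall l : R, l \in `]c^-1, 1] ->
       stieltjes_pos (levyfun alpha M l) (nu l))
    (d : R -> measure_display)
    (T : forall l : R, measurableType (d l))
    (P : forall l : R, probability (T l) R)
    (V : forall l : R, {RV (P l) >-> R})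
    (V_ge0 : forall l : R, l \in `]c^-1, 1] ->
       {ae P l, forall w, 0 <= V l w})
    (V_charfun : forall l : R, l \in `]c^-1, 1] ->
       has_levy_charfun (V l) (nu l))
    (M_cont : {in `]0, +oo[, continuous M})
    (l : R) (l_in : l \in `]c^-1, 1]) :
  ((Hdist alpha c V l x - Hdist alpha c V l 0) / x @[x --> 0^'+]
     --> M (l `^ alpha^-1)) /\
  (Hdist alpha c V l x / x @[x --> 0^'+] --> M (l `^ alpha^-1)).
Proof.
have [a0 a1] := andP alpha01.
have c0 : 0 < c by exact: lt_trans c_gt1.
have l0 : 0 < l.
  move: l_in; rewrite in_itv/= => /andP[+ _].
  by apply: lt_trans; rewrite invr_gt0.
suff H : Hdist alpha c V l x / x @[x --> 0^'+] --> M (l `^ alpha^-1).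
  split=> //; rewrite (_ : (fun x => _) = (fun x => Hdist alpha c V l x / x))//.
  by apply/funext => x; rewrite [X in _ - X]/Hdist ltxx subr0.
pose q := c `^ alpha^-1; pose g x := - levyfun alpha M l x.
have q0 : 0 < q by exact: powR_gt0.
have qa : q `^ alpha = c by rewrite -powRrM mulVf ?gt_eqF// powRr1// ltW.
(* Here [alpha < 1] enters: it gives c < q, on which the integrability of 1 - cos near 0 rests. *)
have cq : c < q.
  rewrite /q /powR gt_eqF// -[ltLHS]lnK// ltr_expR.
  by rewrite ltr_pMl ?ln_gt0// invf_gt1.
have nuE (a b : R) : 0 < a -> a < b -> nu l `]a, b]%classic = (g a - g b)%:E.
  by move=> a_0 ab; rewrite (nu_levy _ l_in _ _ a_0 ab) /g opprK addrC.
have g_scale a : 0 < a -> g (q^-1 * a) = c * g a.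
  move=> a_0; rewrite /g /levyfun -[in LHS]M_period ?mulr_gt0 ?powR_gt0 ?invr_gt0//.
  rewrite powRM ?invr_ge0 ?ltW// -/q mulrCA (mulrA q) divff ?gt_eqF// mul1r.
  rewrite -(powR_inv1 (ltW q0)) powRAC qa powR_inv1 ?(ltW c0)//.
  by field; rewrite !gt_eqF// powR_gt0.
have fin_nu (a b : R) : 0 < a -> a < b -> (nu l `]a, b]%classic < +oo)%E.
  by move=> a_0 ab; rewrite nuE// ltry.
have mcos u : measurable_fun setT (fun x : R => cos (u * x)).
  by apply: measurableT_comp => //; apply: continuous_measurable_fun; exact: continuous_cos.
have msin u : measurable_fun setT (fun x : R => sin (u * x)).
  by apply: measurableT_comp => //; apply: continuous_measurable_fun; exact: continuous_sin.
have self_scale (f : R -> R) : measurable_fun setT f ->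
    \int[nu l]_(x in `]0, +oo[) f (q^-1 * x) = c^-1 * \int[nu l]_(x in `]0, +oo[) f x.
  move=> mf; apply: Rintegral_scale_pos => //; first by rewrite invr_gt0.
  move=> a b a_0 ab.
  have gq y : 0 < y -> g (q * y) = c^-1 * g y.
    move=> y0; have := g_scale (q * y) (mulr_gt0 q0 y0).
    by rewrite mulKf ?gt_eqF// => ->; rewrite mulKf ?gt_eqF.
  have b0 := lt_trans a_0 ab.
  by rewrite !nuE ?mulr_gt0 ?ltr_pM2l// !gq// -EFinM mulrBr.
pose h t := hindex c l t.
have hin t : 0 < t -> h t \in `]c^-1, 1] by move=> t0; exact: hindex_itv.
(* Each [W t] may live on a different probability space; only the laws [mu t] on the line are
   compared. *)
pose W t : {RV P (h t) >-> R} := (t `^ alpha^-1) \o* V (h t).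
pose mu t : probability R R := distribution (P (h t)) (W t).
pose B u := \int[nu l]_(x in `]0, +oo[) sin (u * x).
have key : t^-1 * fine (mu t `[1, +oo[%classic) @[t --> 0^'+] --> g 1.
  apply: (@small_time_tail R (nu l) q c g c_gt1 cq nuE g_scale mu B).
  - move=> t t0; rewrite -[mu t _]/(P (h t) (W t @^-1` `]-oo, 0[%classic)).
    apply: measure_negligible.
      by rewrite -[X in measurable X]setTI; exact: measurable_funP.
    apply: negligibleS (V_ge0 _ (hin _ t0)).
    move=> w; rewrite /= in_itv/= => Wlt /= V0.
    by move: Wlt; rewrite ltNge mulr_ge0// powR_ge0.
  - move=> t u t0; pose tau := t `^ alpha^-1.
    have tau0 : 0 < tau by exact: powR_gt0.
    transitivity (\int[P (h t)]_w cos ((u * tau) * V (h t) w)).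
      rewrite /Rintegral (integral_distribution (X := W t)) /=.
      - by congr fine; apply: eq_integral => w _ /=; rewrite -mulrA (mulrC tau).
      - by apply/measurable_EFinP; exact: mcos.
      - apply: (@probability_integrable _ _ _ _ (fun w => cos (u * W t w)) 1) => [|w].
          by apply: measurableT_comp (mcos u) _.
        exact: cos_max.
    rewrite (Re_levy_charfun _ (V_charfun _ (hin _ t0))).
    (* The scaling of the Levy functions, transferred to integrals; it makes the exponent of [W t]
       equal to t times that of [V l]. *)
    have scale (f : R -> R) : measurable_fun setT f ->
        \int[nu (h t)]_(x in `]0, +oo[) f (tau * x) = t * \int[nu l]_(x in `]0, +oo[) f x.
      move=> mf; pose y := t `^ (- alpha^-1); have y0 : 0 < y by exact: powR_gt0.
      have -> : tau = y^-1 by rewrite /y powRN invrK.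
      apply: Rintegral_scale_pos => // a b a_0 ab.
      rewrite (nu_levy _ (hin _ t0)) ?mulr_gt0 ?ltr_pM2l//.
      rewrite !levyfun_hindex ?(lt_trans a_0 ab)// (nu_levy _ l_in)//.
      by rewrite -EFinM mulrBr.
    congr (expR _ * cos _).
      have := scale (fun x => cos (u * x) - 1) (measurable_funB (mcos u) (measurable_cst _)).
      under [LHS]eq_Rintegral do rewrite mulrA.
      move=> ->; rewrite -mulrN; congr (t * _).
      rewrite -[RHS]mulN1r -RintegralZl//; last first.
        exact: levy_integrable_onem_cos c_gt1 cq nuE g_scale u.
      by apply: eq_Rintegral => x _; rewrite mulN1r opprB.
    by rewrite /B -scale//; apply: eq_Rintegral => x _; rewrite mulrA.
  - move=> u /=; rewrite -self_scale; last exact: measurable_onem_cos.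
    by apply: eq_Rintegral => x _; rewrite mulrCA mulrA.
  - move=> u; rewrite /B -self_scale; last exact: msin.
    by apply: eq_Rintegral => x _; rewrite mulrCA mulrA.
  (* Continuity of [M] is used only at l^(1/alpha), where it gives continuity of [g] at 1. *)
  - have l'0 : 0 < l `^ alpha^-1 by exact: powR_gt0.
    have cM : M (l `^ alpha^-1 * x) @[x --> (1 : R)] --> M (l `^ alpha^-1 * 1).
      apply: (@continuous_comp _ _ _ ( *%R (l `^ alpha^-1)) M); first exact: mulrl_continuous.
      by apply: M_cont; rewrite in_itv/= andbT mulr1.
    have cp : x `^ alpha @[x --> (1 : R)] --> (1 : R) `^ alpha.
      suff : {for (1 : R), continuous ((@powR R)^~ alpha)} by [].
      apply: differentiable_continuous; apply/derivable1_diffP.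
      apply: derivable_powR.
      by rewrite in_itv/= andbT.
    rewrite /continuous_at /g /levyfun; apply: cvgN; apply: cvgM; first exact: cvgN.
    by apply: cvgV cp; rewrite powR1 oner_neq0.
have <- : g 1 = M (l `^ alpha^-1).
  by rewrite /g /levyfun mulr1 powR1 divr1 opprK.
apply: cvg_trans key; apply: near_eq_cvg; near=> t.
have t0 : 0 < t by near: t; exact: nbhs_right_gt.
rewrite /Hdist t0 mulrC; congr (fine _ / _).
rewrite /mu /distribution /pushforward; congr (P _ _).
have tau0 : 0 < t `^ alpha^-1 by exact: powR_gt0.
have one_alpha : 1 = 1 `^ alpha :> R by rewrite powR1.
have pE w : 0 < V (h t) w -> (V (h t) w * t `^ alpha^-1) `^ alpha = V (h t) w `^ alpha * t.
  by move=> V0; rewrite powRM ?ltW// -powRrM mulVf ?gt_eqF// powRr1 ?ltW.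
(* For V > 0, V^-alpha <= t means V^alpha t >= 1, that is W_t >= 1; conversely W_t >= 1 forces V >
   0, so the positivity condition in [Hdist] costs nothing. *)
rewrite -/(h t); apply/seteqP; split=> w; rewrite /= in_itv/= andbT.
  move=> V1; have V0 : 0 < V (h t) w.
    by rewrite -(pmulr_lgt0 _ tau0) (lt_le_trans _ V1).
  split=> //; rewrite powRN invf_ple ?posrE ?powR_gt0//.
  rewrite -[t^-1]mul1r ler_pdivrMr// -pE// [leLHS]one_alpha.
  by rewrite ge0_ler_powR ?nnegrE ?(ltW a0) ?mulr_ge0// ltW.
move=> [V0]; rewrite powRN invf_ple ?posrE ?powR_gt0//.
rewrite -[t^-1]mul1r ler_pdivrMr// -pE// !leNgt; apply: contra => V1.
by rewrite [ltRHS]one_alpha gt0_ltr_powR ?nnegrE// mulr_ge0// ltW.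
Unshelve. all: by end_near.
Qed.
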